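(* Consider the nonlinear system $\nu_{k+1}=f(\nu_k,\phi_k)$ with output $\langle\nu_k-\pi^0,\mathcal Y\rangle$, where $f(\nu,\phi)(s',u')=\sum_{x\in\mathsf X}\nu(x)T(x,s')\phi(u'\mid s')$. The small signal (first-order) approximation about $(\pi^0,\phi^0)$, $$\tilde{\mathcal X}_{k+1}=A\tilde{\mathcal X}_k+B\tilde{\mathcal U}_k,\qquad\tilde{\mathcal Y}_k=C^T\tilde{\mathcal X}_k,$$ holds with $$A_{i,j}=P^0(x^j,x^i),\qquad B_{i,j}=\mathbb I\{i=j\}\,\hat\nu^0(s^j),\qquad C_i=\mathcal Y(x^i),\qquad1\le i,j\le n.$$
   Context: $\mathsf S$ and $\mathsf U$ are finite sets, $\mathsf X=\mathsf S\times\mathsf U=\{x^i=(s^i,u^i):1\le i\le n\}$ with $n=|\mathsf X|$. $T$ is a controlled transition matrix ($T(x,\cdot)$ a pmf on $\mathsf S$), $\phi^0$ a nominal randomized policy ($\phi^0(\cdot\mid s)$ a pmf on $\mathsf U$), $P^0(x,x')=T(x,s')\phi^0(u'\mid s')$, $x'=(s',u')$, with unique invariant pmf $\pi^0(s,u)=\phi^0(u\mid s)\hat\nu^0(s)$, so $\hat\nu^0(s)=\sum_u\pi^0(s,u)$. $\mathcal Y:\mathsf X\to\mathbb R$, $\langle\nu,\mathcal Y\rangle=\sum_x\nu(x)\mathcal Y(x)$. The vectors $\tilde{\mathcal X}_k,\tilde{\mathcal U}_k\in\mathbb R^n$ have entries approximating the deviations $\nu_k(x^i)-\pi^0(x^i)$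 and $\phi_k(u^i\mid s^i)-\phi^0(u^i\mid s^i)$, respectively, and $\tilde{\mathcal Y}_k$ approximates $\langle\nu_k-\pi^0,\mathcal Y\rangle$. The small signal approximation is by definition the first-order Taylor approximation: viewing $f$ as a function of the coordinates $\nu^j=\nu(x^j)$ and $\phi^j=\phi(u^j\mid s^j)$, with $f_i=f(\cdot)(x^i)$, $$A_{i,j}=\frac{\partial f_i}{\partial\nu^j}\Big|_{\nu=\pi^0,\phi=\phi^0},\qquad B_{i,j}=\frac{\partial f_i}{\partial\phi^j}\Big|_{\nu=\pi^0,\phi=\phi^0},$$ and $C$ is the vector for which $C^T\tilde\nu=\langle\tilde\nu,\mathcal Y\rangle$ for all $\tilde\nu\in\mathbb R^n$. *)

(* Defs.v *)
From HB Require Import structures.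
From mathcomp Require Import all_boot all_order all_algebra.
From mathcomp Require Import all_classical all_reals all_analysis.
Set Implicit Arguments.
Unset Strict Implicit.
Unset Printing Implicit Defensive.
Import Order.TTheory GRing.Theory Num.Theory numFieldNormedType.Exports.
Local Open Scope classical_set_scope.
Local Open Scope ring_scope.

Definition is_pmf (R : realType) (I : finType) (g : I -> R) : Prop :=
  (forall a, 0 <= g a) /\ \sum_(a : I) g a = 1.

Definition invariant_pmf (R : realType) (I : finType)
    (P : I -> I -> R) (mu : I -> R) : Prop :=
  is_pmf mu /\ forall z', \sum_(z : I) mu z * P z z' = mu z'.

Definition unique_invariant_pmf (R : realType) (I : finType)
    (P : I -> I -> R) (mu : I -> R) : Prop :=
  invariant_pmf P mu /\ forall mu', invariant_pmf P mu' -> mu' =1 mu.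

Definition pairing (R : realType) (I : finType) (nu Y : I -> R) : R :=
  \sum_(z : I) nu z * Y z.

(* [x] enumerates I, and [idx] is the inverse enumeration. *)
Definition to_coords (R : realType) (I : Type) (n : nat)
    (x : 'I_n -> I) (g : I -> R) : 'cV[R]_n := \col_i g (x i).

Definition of_coords (R : realType) (I : Type) (n : nat)
    (idx : I -> 'I_n) (v : 'cV[R]_n) : I -> R := fun z => v (idx z) 0.

Section Controlled.
Variables (R : realType) (S U : finType).

(* A policy is written [phi s u] for phi(u | s). *)
Definition closed_loop (T : S * U -> S -> R) (phi : S -> U -> R)
    (z z' : S * U) : R := T z z'.1 * phi z'.1 z'.2.

Definition state_marginal (mu : S * U -> R) (s : S) : R :=
  \sum_(u : U) mu (s, u).

Definition evolution (T : S * U -> S -> R) (nu : S * U -> R)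
    (phi : S -> U -> R) (z' : S * U) : R :=
  \sum_(z : S * U) nu z * T z z'.1 * phi z'.1 z'.2.

Definition evolution_coords (n : nat) (x : 'I_n -> S * U)
    (idx : S * U -> 'I_n) (T : S * U -> S -> R)
    (w : 'cV[R]_n * 'cV[R]_n) : 'cV[R]_n :=
  to_coords x (evolution T (of_coords idx w.1)
                           (fun s u => of_coords idx w.2 (s, u))).
End Controlled.

(* First-order Taylor approximation, about the equilibrium state p with input
   q, of the system v_(k+1) = F (v_k, w_k) with output L (v_k - p): the linear
   system X_(k+1) = A X_k + B U_k, Y_k = C^T X_k in the deviations X_k from p
   and U_k from q.  The entries of A and B are the partial derivatives of the
   components of F (on the whole space, not relative to the simplex). *)
Definition small_signal_approximation (R : realType) (n m : nat)
    (F : 'cV[R]_n * 'cV[R]_m -> 'cV[R]_n) (L : 'cV[R]_n -> R)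
    (p : 'cV[R]_n) (q : 'cV[R]_m)
    (A : 'M[R]_n) (B : 'M[R]_(n, m)) (C : 'cV[R]_n) : Prop :=
  [/\ F (p, q) = p,
      forall i j, is_derive (p, q) (delta_mx j 0 : 'cV[R]_n, 0 : 'cV[R]_m)
                    (fun w => F w i 0) (A i j),
      forall i j, is_derive (p, q) (0 : 'cV[R]_n, delta_mx j 0 : 'cV[R]_m)
                    (fun w => F w i 0) (B i j),
      unique (fun D : 'cV[R]_n => forall v, (D^T *m v) 0 0 = L v) C
    & (fun h : 'cV[R]_n * 'cV[R]_m =>
         F (p + h.1, q + h.2) - p - (A *m h.1 + B *m h.2))
        =o_ (nbhs (0 : 'cV[R]_n * 'cV[R]_m)) id].

(* Main.v *)
Require Import Defs.
From HB Require Import structures.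
From mathcomp Require Import all_boot all_order all_algebra.
From mathcomp Require Import all_classical all_reals all_analysis.
Import Order.TTheory GRing.Theory Num.Theory numFieldNormedType.Exports.
Local Open Scope ring_scope.

(** In coordinates the dynamics is bilinear: the [i]-th component of
    [f (nu, phi)] is the product of [state_inflow nu i], which is linear in [nu],
    with the single coordinate [phi i].  Expanding about [(pi0, phi0)] therefore
    gives an exact identity, [evolution_coords_expansion]: a constant term, a part
    linear in the deviation [(h.1, h.2)], and the one cross term
    [state_inflow h.1 i * h.2 i].

    The constant term is [pi0] by invariance.  The [nu]-part of the linear term
    keeps [phi0] fixed, so its coefficients are [T (x j) (x i).1 * phi0 (x i)],
    the closed-loop transition probabilities.  The [phi]-part keeps [pi0] fixed,
    so it is diagonal with entries [state_inflow pi0 i]; summing the invariance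
    equation over the actions ([invariant_flow_into_state]) identifies this entry
    with the state marginal of [pi0].

    The partial derivatives can then be read off, because the cross term vanishes
    as soon as only one of the two arguments is perturbed, so that the map is
    exactly affine along each coordinate direction
    ([is_derive_affine_along]).  The same cross term is the whole remainder of the
    joint expansion, and it is at most [n * |h|^2] because [T] has entries in
    [0, 1]; hence it is negligible with respect to [h] ([quadratic_littleo]).  The
    output map is linear, and [C] is its representing vector
    ([pairing_representer]). *)

Lemma sum_enumeration {V : nmodType} {I : finType} {n : nat} {x : 'I_n -> I}
    {idx : I -> 'I_n} (xK : cancel x idx) (idxK : cancel idx x) (g : I -> V) :
  \sum_z g z = \sum_j g (x j).
Proof. by rewrite (reindex x) //; apply: onW_bij; exists idx. Qed.

(** The difference quotient is constant away from 0, so the function need not be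
    known off the line through [a]. *)
Lemma is_derive_affine_along {R : numFieldType} {V : normedModType R}
    (f : V -> R) (a v : V) (d : R) :
  (forall h, f (a + h *: v) = f a + h * d) -> is_derive a v f d.
Proof.
move=> f_affine.
have cvg_d : (h^-1 *: ((f \o shift a) (h *: v) - f a) @[h --> 0^'] --> d)%classic.
  apply: cvg_near_cst; near=> h.
  have h_neq0 : h != 0 by near: h; exact: nbhs_dnbhs_neq.
  rewrite /= [_ *: v + a]addrC f_affine addrAC subrr add0r.
  by rewrite /GRing.scale /= mulKf.
split; last exact: cvg_lim.
by apply/cvg_ex; exists d.
Unshelve. all: by end_near.
Qed.

Lemma coord_le_norm {R : realType} {n : nat} (v : 'cV[R]_n) (i : 'I_n) :
  `|v i 0| <= `|v|.
Proof. by rewrite [leRHS]mx_normrE; exact: (le_bigmax _ _ (i, 0)). Qed.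

Lemma norm_le_coord {R : realType} {n : nat} (v : 'cV[R]_n) (c : R) :
  0 <= c -> (forall i, `|v i 0| <= c) -> `|v| <= c.
Proof.
move=> c_ge0 vc; rewrite [leLHS]mx_normrE; apply: bigmax_le => //.
by move=> [i j] _ /=; rewrite ord1.
Qed.

(** Inside the ball of radius [e / (|K| + 1)], one of the two factors [|h|] is
    absorbed by [K]. *)
Lemma quadratic_littleo {R : realType} {V W : normedModType R}
    (f : V -> W) (K : R) :
  (forall h, `|f h| <= K * `|h| ^+ 2) -> f =o_ (nbhs (0 : V)) id.
Proof.
move=> fK; apply/eqoP => _/posnumP[e].
have K1_gt0 : 0 < `|K| + 1 by rewrite ltr_pwDr.
near=> h.
have h_small : `|h| <= e%:num / (`|K| + 1).
  by near: h; apply: nbhs0_le; exact: divr_gt0.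
apply: (le_trans (fK h)); rewrite expr2 mulrA ler_wpM2r //.
rewrite ler_pdivlMr // mulrC in h_small.
apply: le_trans h_small; rewrite ler_wpM2r //.
by rewrite (le_trans (ler_norm K)) // lerDl.
Unshelve. all: by end_near.
Qed.

Lemma pmf_le1 {R : realType} {I : finType} (g : I -> R) (a : I) :
  is_pmf g -> g a <= 1.
Proof.
by move=> [g_ge0 <-]; rewrite (bigD1 a) //= lerDl sumr_ge0.
Qed.

(** Summing the invariance equation over the actions [u] removes the policy, since
    [phi s] has total mass 1. *)
Lemma invariant_flow_into_state {R : realType} {S U : finType}
    (T : S * U -> S -> R) (phi : S -> U -> R) (mu : S * U -> R) (s : S) :
  is_pmf (phi s) -> invariant_pmf (closed_loop T phi) mu ->
  \sum_z mu z * T z s = state_marginal mu s.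
Proof.
move=> [_ phi_sum1] [_ mu_inv]; rewrite /state_marginal.
under [RHS]eq_bigr do rewrite -mu_inv.
rewrite exchange_big /=; apply: eq_bigr => z _.
by rewrite /closed_loop /= -mulr_sumr -mulr_sumr phi_sum1 mulr1.
Qed.

(** The next-state marginal of the signed measure with coordinates [v].  It is
    indexed by state-action pairs, although it depends only on the state of [x i],
    so that it multiplies the [i]-th policy coordinate directly. *)
Definition state_inflow {R : realType} {S U : finType} {n : nat}
    (x : 'I_n -> S * U) (T : S * U -> S -> R) (v : 'cV[R]_n) (i : 'I_n) : R :=
  \sum_j v j 0 * T (x j) (x i).1.

Section Expansion.
Context {R : realType} {S U : finType} {n : nat} {x : 'I_n -> S * U}
  {idx : S * U -> 'I_n} (xK : cancel x idx) (idxK : cancel idx x)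
  (T : S * U -> S -> R).

Local Notation flow := (state_inflow x T).

Lemma evolution_coordsE (w : 'cV[R]_n * 'cV[R]_n) (i : 'I_n) :
  evolution_coords x idx T w i 0 = flow w.1 i * w.2 i 0.
Proof.
rewrite mxE /evolution (sum_enumeration xK idxK) /state_inflow mulr_suml.
by apply: eq_bigr => j _; rewrite /of_coords xK -surjective_pairing xK.
Qed.

Lemma state_inflowD (v v' : 'cV[R]_n) (i : 'I_n) :
  flow (v + v') i = flow v i + flow v' i.
Proof.
by rewrite /state_inflow -big_split /=; apply: eq_bigr => j _; rewrite mxE mulrDl.
Qed.

Lemma state_inflow_le (hT : forall z, is_pmf (T z)) (v : 'cV[R]_n) (i : 'I_n) :
  `|flow v i| <= n%:R * `|v|.
Proof.
apply: (le_trans (ler_norm_sum _ _ _)).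
rewrite mulr_natl -[X in _ *+ X]card_ord -sumr_const.
apply: ler_sum => j _; rewrite normrM -[leRHS]mulr1.
apply: ler_pM => //; first exact: coord_le_norm.
by rewrite ger0_norm ?pmf_le1 //; have [] := hT (x j).
Qed.

(** The product [state_inflow nu i * phi i] multiplied out about [(mu, phi0)]:
    there are four terms, and only the last is not of degree at most one.  As the
    identity is exact, it serves the fixed point, both families of partial
    derivatives and the joint expansion alike. *)
Lemma evolution_coords_expansion {phi0 : S -> U -> R} {mu : S * U -> R}
    (hphi0 : forall s, is_pmf (phi0 s))
    (hmu : invariant_pmf (closed_loop T phi0) mu)
    (h : 'cV[R]_n * 'cV[R]_n) (i : 'I_n) :
  let q := to_coords x (fun z => phi0 z.1 z.2) in
  let A := \matrix_(i, j) closed_loop T phi0 (x j) (x i) in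
  let B := \matrix_(i, j) ((i == j)%:R * state_marginal mu (x j).1) in
  evolution_coords x idx T (to_coords x mu + h.1, q + h.2) i 0 =
  to_coords x mu i 0 + (A *m h.1 + B *m h.2) i 0 + state_inflow x T h.1 i * h.2 i 0.
Proof.
move=> q A B.
have flow_mu : flow (to_coords x mu) i = state_marginal mu (x i).1.
  rewrite -(invariant_flow_into_state T phi0) // (sum_enumeration xK idxK).
  by apply: eq_bigr => j _; rewrite mxE.
have fixed : flow (to_coords x mu) i * q i 0 = to_coords x mu i 0.
  rewrite /state_inflow !mxE -(hmu.2 (x i)) (sum_enumeration xK idxK) mulr_suml.
  by apply: eq_bigr => j _; rewrite mxE /closed_loop mulrA.
have Ah : (A *m h.1) i 0 = flow h.1 i * q i 0.
  rewrite !mxE /state_inflow mulr_suml; apply: eq_bigr => j _.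
  by rewrite mxE /closed_loop mulrC mulrA.
have Bh : (B *m h.2) i 0 = flow (to_coords x mu) i * h.2 i 0.
  rewrite flow_mu !mxE (bigD1 i) //= big1 ?addr0 => [|j ji].
    by rewrite mxE eqxx mul1r.
  by rewrite mxE eq_sym (negbTE ji) !mul0r.
rewrite [X in _ + X + _]mxE Ah Bh evolution_coordsE /= state_inflowD.
rewrite [X in _ * X]mxE mulrDr !mulrDl fixed.
by rewrite -!addrA; congr (_ + _); rewrite addrA.
Qed.

End Expansion.

(** Uniqueness comes from testing against the coordinate vectors. *)
Lemma pairing_representer {R : realType} {I : finType} {n : nat}
    {x : 'I_n -> I} {idx : I -> 'I_n} (xK : cancel x idx)
    (idxK : cancel idx x) (Y : I -> R) :
  unique (fun D : 'cV[R]_n =>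
      forall v, (D^T *m v) 0 0 = pairing (of_coords idx v) Y)
    (\col_i Y (x i)).
Proof.
split=> [v|D repD].
  rewrite mxE /pairing (sum_enumeration xK idxK).
  by apply: eq_bigr => j _; rewrite !mxE /of_coords xK mulrC.
have repY (v : 'cV[R]_n) : pairing (of_coords idx v) Y = \sum_j v j 0 * Y (x j).
  rewrite /pairing (sum_enumeration xK idxK).
  by apply: eq_bigr => j _; rewrite /of_coords xK.
apply/matrixP => i k; rewrite ord1 mxE.
have := repD (delta_mx i 0); rewrite -colE !mxE repY => ->.
rewrite (bigD1 i) //= big1 ?addr0 => [|j ji]; rewrite mxE ?eqxx ?mul1r //.
by rewrite (negbTE ji) mul0r.
Qed.

Theorem proposition3p3 (R : realType) (S U : finType)
    (n : nat) (hn : n = #|{: S * U}|)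
    (x : 'I_n -> S * U) (idx : S * U -> 'I_n)
    (xK : cancel x idx) (idxK : cancel idx x)
    (T : S * U -> S -> R) (phi0 : S -> U -> R)
    (pi0 : S * U -> R) (Y : S * U -> R)
    (hT : forall z, is_pmf (T z))
    (hphi0 : forall s, is_pmf (phi0 s))
    (hpi0 : unique_invariant_pmf (closed_loop T phi0) pi0) :
  small_signal_approximation
    (evolution_coords x idx T)
    (fun v => pairing (of_coords idx v) Y)
    (to_coords x pi0)
    (to_coords x (fun z => phi0 z.1 z.2))
    (\matrix_(i, j) closed_loop T phi0 (x j) (x i))
    (\matrix_(i, j) ((i == j)%:R * state_marginal pi0 (x j).1))
    (\col_i Y (x i)).
Proof.
have [pi0_inv _] := hpi0.
have expansion := evolution_coords_expansion xK idxK T hphi0 pi0_inv.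
have fixed : evolution_coords x idx T
    (to_coords x pi0, to_coords x (fun z => phi0 z.1 z.2)) = to_coords x pi0.
  apply/matrixP => i k; rewrite ord1; have := expansion (0, 0) i.
  rewrite /= !mulmx0 !addr0 => ->.
  by rewrite [X in _ * X]mxE [X in _ + X + _]mxE mulr0 !addr0.
split.
- exact: fixed.
- move=> i j; apply: is_derive_affine_along => h; rewrite fixed.
  have -> : h *: (delta_mx j 0 : 'cV[R]_n, 0 : 'cV[R]_n) =
            (h *: delta_mx j 0, 0) by congr pair; exact: scaler0.
  rewrite expansion /= mulmx0 addr0 [X in _ + _ * X]mxE mulr0 addr0.
  by rewrite -scalemxAr -colE [X in _ + X]mxE [X in _ * X]mxE.
- move=> i j; apply: is_derive_affine_along => h; rewrite fixed.
  have -> : h *: (0 : 'cV[R]_n, delta_mx j 0 : 'cV[R]_n) =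
            (0, h *: delta_mx j 0) by congr pair; exact: scaler0.
  rewrite expansion /= mulmx0 add0r.
  rewrite [state_inflow _ _ 0 _]big1 ?mul0r ?addr0 => [|k _];
    last by rewrite mxE mul0r.
  by rewrite -scalemxAr -colE [X in _ + X]mxE [X in _ * X]mxE.
- exact: pairing_representer.
- apply: (quadratic_littleo _ n%:R) => h; apply: norm_le_coord => [|i].
    by rewrite mulr_ge0 // sqr_ge0.
  rewrite [X in `|X|]mxE [X in `|X + _|]mxE expansion.
  rewrite [X in `|_ + X + _|]mxE [X in `|_ + X|]mxE.
  (* Subtracting the constant and linear terms leaves only the cross term. *)
  rewrite [X in `|X|](_ : _ = state_inflow x T h.1 i * h.2 i 0);
    last by rewrite -[LHS]addrA -opprD addrAC subrr add0r.
  rewrite normrM expr2 mulrA; apply: ler_pM => //.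
    apply: (le_trans (state_inflow_le T hT h.1 i)); rewrite ler_wpM2l //.
    by rewrite prod_normE le_max lexx.
  apply: (le_trans (coord_le_norm _ _)).
  by rewrite prod_normE le_max lexx orbT.
Qed.
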